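(* Let $P$ be a $\mu$-reversible Markov kernel on $(E,\mathscr{E})$, with $\mu$ its unique invariant probability measure, such that: (1) there exist a set $C\in\mathscr{E}$, a function $V:E\to[1,\infty)$ and $b>0$ such that $$PV\le V-\phi\circ V+b\mathbf{1}_C,$$ where $\phi:[1,\infty)\to(0,\infty)$ is a concave, continuous and increasing function; (2) a local Poincaré inequality holds: there exists $K>0$ such that for any $f\in L^2(\mu)$, $$\|f_m\mathbf{1}_C\|_2^2\le K\,\mathcal{E}(P,f),\qquad\text{with } m=\mu(f\cdot\mathbf{1}_C)/\mu(C)\text{ and } f_m:=f-m .$$ Then for any $f\in L^2_0(\mu)$ and $s>0$, $$\|f\|_2^2\le s\,\mathcal{E}(P,f)+\beta(s)\|f\|_{\mathrm{osc}}^2,\qquad\text{where}\quad \beta(s):=\frac{b\,\mu(C)}{\phi\circ(\mathrm{Id}/\phi)^{-1}\big(s/(1+Kb)\big)} .$$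
   Context: $(E,\mathscr{E})$ is a measurable space, $\mu$ a probability measure on it. $\|\cdot\|_2$ is the norm of $L^2(\mu)$; $L^2_0(\mu)$ is the set of real $f\in L^2(\mu)$ with $\mu(f)=0$; $\|f\|_{\mathrm{osc}}=\mathrm{ess}_\mu\sup f-\mathrm{ess}_\mu\inf f$; $\mathcal{E}(P,f)=\langle(\mathrm{Id}-P)f,f\rangle$ in $L^2(\mu)$. $(\mathrm{Id}/\phi)^{-1}$ denotes the inverse of the function $x\mapsto x/\phi(x)$.
   Formalization: (Id/φ)^{-1}(r) is read as inf{x≥1 : x/φ(x)≥r}, with φ(+∞)=+∞ (so β=0) if no such x exists: the literal inverse is undefined for many s, and when Id/φ is decreasing (e.g. φ(x)=x−1/2) the literal claim is false. V is taken measurable. *)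

(* Defs.v *)
(* MathComp-Analysis *)
From HB Require Import structures.
From mathcomp Require Import all_boot all_order all_algebra.
From mathcomp Require Import all_classical all_reals all_analysis.
From mathcomp Require Import ess_sup_inf.

Set Implicit Arguments.
Unset Strict Implicit.
Unset Printing Implicit Defensive.

Import Order.TTheory GRing.Theory Num.Theory.
Import numFieldNormedType.Exports.

Local Open Scope classical_set_scope.
Local Open Scope ring_scope.

Definition kernel_invariant (d : measure_display) (T : measurableType d)
    (R : realType) (P : R.-pker T ~> T) (nu : probability T R) : Prop :=
  forall A : set T, measurable A -> (\int[nu]_x P x A = nu A)%E.

Definition unique_invariant (d : measure_display) (T : measurableType d)
    (R : realType) (P : R.-pker T ~> T) (mu : probability T R) : Prop :=
  kernel_invariant P mu /\
  forall nu : probability T R, kernel_invariant P nu ->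
    forall A : set T, measurable A -> nu A = mu A.

Definition kernel_reversible (d : measure_display) (T : measurableType d)
    (R : realType) (P : R.-pker T ~> T) (mu : probability T R) : Prop :=
  forall A B : set T, measurable A -> measurable B ->
    (\int[mu]_(x in A) P x B = \int[mu]_(x in B) P x A)%E.

(* Action on real functions.  For f in L^2(mu) and mu invariant the integral
   is finite for mu-almost every x; elsewhere Rintegral returns a junk value,
   which does not affect the inner products below. *)
Definition kernel_op (d : measure_display) (T : measurableType d)
    (R : realType) (P : R.-pker T ~> T) (f : T -> R) : T -> R :=
  fun x => \int[P x]_y f y.

Definition inner2 (d : measure_display) (T : measurableType d)
    (R : realType) (mu : probability T R) (f g : T -> R) : R :=
  \int[mu]_x (f x * g x).

Definition dirichlet (d : measure_display) (T : measurableType d)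
    (R : realType) (mu : probability T R) (P : R.-pker T ~> T)
    (f : T -> R) : R :=
  inner2 mu (f \- kernel_op P f) f.

Definition norm2 (d : measure_display) (T : measurableType d)
    (R : realType) (mu : probability T R) (f : T -> R) : \bar R :=
  'N[mu]_2%:E[EFin \o f].

(* +oo when f is not essentially bounded *)
Definition osc (d : measure_display) (T : measurableType d)
    (R : realType) (mu : probability T R) (f : T -> R) : \bar R :=
  (ess_sup mu (EFin \o f) - ess_inf mu (EFin \o f))%E.

(* Inverse of a function on [1, +oo[, made total as the usual generalized
   inverse inf {x >= 1 | r <= g x}: it is the inverse on the range of g when g
   is increasing (geninvK), 1 below that range and +oo (inf of the empty set)
   above it. *)
Definition geninv (R : realType) (g : R -> R) (r : R) : \bar R :=
  ereal_inf (EFin @` [set x | 1 <= x /\ r <= g x]).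

Lemma geninvK (R : realType) (g : R -> R) (x : R) :
  {in `[1, +oo[ &, {homo g : y z / y < z}} -> 1 <= x ->
  geninv g (g x) = x%:E.
Proof.
move=> gmono x1; apply/le_anti/andP; split.
  by apply: ereal_inf_lbound; exists x.
apply: le_ereal_inf_tmp => _ [y [y1 gxy] <-]; rewrite lee_fin leNgt.
apply/negP => yx; move: gxy; rewrite leNgt gmono //; by rewrite in_itv/= andbT.
Qed.

(* The composite phi o (Id/phi)^{-1} is er_map phi (geninv ...), with
   phi(+oo) = +oo.  This is the limit of phi whenever it matters: geninv is
   +oo only if phi x > x / r for all x >= 1, and then phi tends to +oo. *)
Definition wpi_beta (d : measure_display) (T : measurableType d)
    (R : realType) (mu : probability T R) (C : set T) (phi : R -> R)
    (b K s : R) : \bar R :=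
  (b%:E * mu C /
    er_map phi (geninv (fun x => x / phi x)%R (s / (1 + K * b))%R))%E.

(* Main.v *)
Require Import Defs.
From HB Require Import structures.
From mathcomp Require Import all_boot all_order all_algebra finmap.
From mathcomp Require Import all_classical all_reals all_analysis.
From mathcomp Require Import ess_sup_inf measurable_realfun ring lra.

Set Implicit Arguments.
Unset Strict Implicit.
Unset Printing Implicit Defensive.

Import Order.TTheory GRing.Theory Num.Theory.
Import numFieldNormedType.Exports.

Local Open Scope classical_set_scope.
Local Open Scope ring_scope.

(** Write E(g) for the Dirichlet form, let m be the mean of f over C and
   g := f - m, so that E(g) = E(f).  By reversibility and AM-GM, every
   function V > 0 satisfies <|g|, P|g|> <= <g^2 / V, P V>; inserting the drift
   condition gives
     int g^2 phi(V)/V <= E(g) + b int_C g^2 <= (1 + K b) E(f).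
   Let r := s / (1 + K b).  Where V / phi(V) <= r, the integrand on the left
   is at least g^2 / r.  Elsewhere V >= (Id/phi)^{-1}(r), and the measure of
   this set is bounded by Markov's inequality, because integrating the drift
   condition, with V truncated at n to be integrable, yields
   int phi(V) <= b mu(C).  On that set |g| <= osc f, since m lies between the
   essential bounds of f.  Finally ||f||^2 <= ||g||^2 as f is centred. *)

(** * Induction on nonnegative measurable functions *)

Section ge0_measurable_induction.
Context (R : realType) (d : measure_display) (T : measurableType d).
Local Open Scope ereal_scope.
Import HBNNSimple.
Variable Q : (T -> \bar R) -> Prop.
Hypothesis Qindic : forall A, measurable A -> Q (fun x => (\1_A x)%:E).
Hypothesis QD : forall f g : T -> \bar R,
  (forall x, 0 <= f x) -> measurable_fun setT f ->
  (forall x, 0 <= g x) -> measurable_fun setT g ->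
  Q f -> Q g -> Q (f \+ g).
Hypothesis QZ : forall (k : R) (f : T -> \bar R), (0 <= k)%R ->
  (forall x, 0 <= f x) -> measurable_fun setT f ->
  Q f -> Q (fun x => k%:E * f x).
Hypothesis Qlim : forall f_ : (T -> \bar R)^nat,
  (forall n x, 0 <= f_ n x) -> (forall n, measurable_fun setT (f_ n)) ->
  (forall x, nondecreasing_seq (f_ ^~ x)) ->
  (forall n, Q (f_ n)) -> Q (fun x => limn (f_ ^~ x)).

(** [f] is the increasing limit of nonnegative simple functions, each a finite sum of multiples of
    indicators; the hypotheses on [Q] climb this ladder. *)
Lemma ge0_measurable_ind f :
  (forall x, 0 <= f x) -> measurable_fun setT f -> Q f.
Proof using Qindic QD QZ Qlim.
move=> f0 mf.
have Q0 : Q (cst 0).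
  rewrite (_ : cst 0 = fun x => (\1_(@set0 T) x)%:E); first exact: Qindic.
  by apply/funext => x; rewrite indic0.
have Qnnsfun (h : {nnsfun T >-> R}) : Q (EFin \o h).
  have -> : EFin \o h = (fun x => \sum_(y <- fset_set (range h))
      (y * \1_(h @^-1` [set y]) x)%:E).
    apply/funext => x /=; rewrite [in LHS]fimfunE fsbig_finite//=.
    by rewrite sumEFin.
  have t0 y x : 0 <= (y * \1_(h @^-1` [set y]) x)%:E.
    by rewrite EFinM nnfun_muleindic_ge0.
  have tm y : measurable_fun setT (fun x => (y * \1_(h @^-1` [set y]) x)%:E).
    by apply/measurable_EFinP; apply: measurable_funM.
  elim: (fset_set (range h) : seq R) => [|y r ih].
    by rewrite (_ : (fun _ => _) = cst 0)//; apply/funext => x; rewrite big_nil.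
  rewrite (_ : (fun _ => _) = (fun x => (y * \1_(h @^-1` [set y]) x)%:E) \+
    (fun x => \sum_(z <- r) (z * \1_(h @^-1` [set z]) x)%:E)); last first.
    by apply/funext => x; rewrite big_cons.
  apply: QD => //.
  - by move=> x; exact: sume_ge0.
  - exact: emeasurable_sum.
  (* The induction runs over an arbitrary list of values, so negative ones must be treated; their
     preimage under [h] is empty and the term vanishes. *)
  - have [y0|y0] := leP 0%R y.
      rewrite (_ : (fun _ => _) =
        (fun x => y%:E * (\1_(h @^-1` [set y]) x)%:E))//.
      apply: QZ => //; last exact: Qindic.
      by apply/measurable_EFinP.
    rewrite (_ : (fun _ => _) = cst 0)//; apply/funext => x.
    by rewrite preimage_nnfun0// indic0 mulr0.
pose f_ := nnsfun_approx measurableT mf.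
rewrite (_ : f = fun x => limn ((fun n y => (f_ n y)%:E) ^~ x)); last first.
  by apply/funext => x; apply/esym/cvg_lim => //; exact: cvg_nnsfun_approx.
apply: Qlim => //.
- by move=> n x; rewrite lee_fin.
- by move=> n; exact/measurable_EFinP.
- by move=> x m n mn; rewrite lee_fin; exact/lefP/nd_nnsfun_approx.
- by move=> n; exact: Qnnsfun.
Qed.

End ge0_measurable_induction.

(** The factor [c] may be [+oo]. The product rule is then in doubt only for a zero limit, and
    monotonicity makes every term zero in that case. *)
Lemma ge0_nondecreasing_limeMr (R : realType) (f : (\bar R)^nat) (c : \bar R) :
  (forall n, 0 <= f n)%E -> nondecreasing_seq f -> (0 <= c)%E ->
  limn (fun n => f n * c)%E = (limn f * c)%E.
Proof.
move=> f0 ndf c0; have cf := ereal_nondecreasing_is_cvgn ndf.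
have [lf0|lf0] := eqVneq (limn f) 0%E.
  rewrite lf0 mul0e (_ : (fun _ => _) = cst 0%E) ?lim_cst//.
  apply/funext => n; rewrite (_ : f n = 0%E) ?mul0e//.
  apply/le_anti; rewrite f0 andbT -[leRHS]lf0.
  rewrite (cvg_lim _ (ereal_nondecreasing_cvgn ndf))//.
  by apply: ereal_sup_ubound; exists n.
have [cfin|] := boolP (c \is a fin_num); first exact: limeMr.
rewrite ge0_fin_numE// -leNgt leye_eq => /eqP ->.
have := @limeM _ _ _ _ f (cst +oo%E) cf (is_cvg_cst _).
by rewrite lim_cst//; apply; apply: neq0_mule_def; rewrite mule_eq0 negb_or lf0.
Qed.

(** * Reversibility for nonnegative functions *)

Section reversible.
Context (R : realType) (d : measure_display) (T : measurableType d).
Variables (mu : probability T R) (P : R.-pker T ~> T).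
Hypothesis Prev : kernel_reversible P mu.
Local Open Scope ereal_scope.

Lemma measurable_kernel_integral (u : T -> \bar R) :
  (forall x, 0 <= u x) -> measurable_fun setT u ->
  measurable_fun setT (fun x => \int[P x]_y u y).
Proof.
by move=> u0 mu_; apply: measurable_fun_integral_kernel => // U mU;
  exact: measurable_kernel.
Qed.

Let rev u v := \int[mu]_x (u x * \int[P x]_y v y) =
  \int[mu]_x (v x * \int[P x]_y u y).

(** For fixed [v] both sides are additive, homogeneous and continuous along increasing sequences in
    [u]. On the right [u] sits under two integrals, hence two uses of monotone convergence. *)
Let rev_ind v : (forall x, 0 <= v x) -> measurable_fun setT v ->
  (forall A, measurable A -> rev (fun x => (\1_A x)%:E) v) ->
  forall u, (forall x, 0 <= u x) -> measurable_fun setT u -> rev u v.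
Proof.
move=> v0 mv revA.
have Pv0 x : 0 <= \int[P x]_y v y by exact: integral_ge0.
have mPv := measurable_kernel_integral v0 mv.
apply: (@ge0_measurable_ind _ _ _ (rev ^~ v)); first exact: revA.
- move=> f g f0 mf g0 mg rf rg; rewrite /rev.
  under eq_integral do rewrite /= ge0_muleDl//.
  under [RHS]eq_integral do rewrite ge0_integralD//.
  under [RHS]eq_integral do rewrite ge0_muleDr ?integral_ge0//.
  rewrite !ge0_integralD; first by rewrite rf rg.
  all: try by [move=> x _; rewrite mule_ge0// integral_ge0 | exact: measurableT].
  1-4: by apply: emeasurable_funM => //; exact: measurable_kernel_integral.
- move=> k f k0 f0 mf rf; rewrite /rev.
  under eq_integral do rewrite -muleA.
  under [RHS]eq_integral do rewrite ge0_integralZl_EFin// muleCA.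
  rewrite !ge0_integralZl_EFin; first by rewrite rf.
  all: try by [move=> x _; rewrite mule_ge0// integral_ge0 | exact: measurableT
    | exact: k0].
  1-2: by apply: emeasurable_funM => //; exact: measurable_kernel_integral.
- move=> f_ f0 mf ndf rf; rewrite /rev.
  have Pf0 n x : 0 <= \int[P x]_y f_ n y by exact: integral_ge0.
  have mPf n := measurable_kernel_integral (f0 n) (mf n).
  have ndPf x : nondecreasing_seq (fun n => \int[P x]_y f_ n y).
    by move=> m n mn; apply: ge0_le_integral => // y _; exact: ndf.
  transitivity (\int[mu]_x limn (fun n => f_ n x * \int[P x]_y v y)).
    by apply: eq_integral => x _; rewrite ge0_nondecreasing_limeMr.
  transitivity (\int[mu]_x limn (fun n => v x * \int[P x]_y f_ n y)); last first.
    apply: eq_integral => x _.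
    have -> : \int[P x]_y limn (f_ ^~ y) = limn (fun n => \int[P x]_y f_ n y).
      exact: monotone_convergence.
    rewrite [RHS]muleC -ge0_nondecreasing_limeMr; [|by []|exact: ndPf|exact: v0].
    by congr (limn _); apply/funext => n; rewrite muleC.
  rewrite !monotone_convergence; try exact: measurableT.
  + by congr (limn _); apply/funext => n; exact: rf.
  + by move=> n; exact: emeasurable_funM.
  + by move=> n x _; rewrite mule_ge0.
  + by move=> x _ m n mn; rewrite lee_wpmul2l// ndPf.
  + by move=> n; exact: emeasurable_funM.
  + by move=> n x _; rewrite mule_ge0.
  + by move=> x _ m n mn; rewrite lee_wpmul2r// ndf.
Qed.

(* Reversibility gives the case of two indicators; the induction principle is
   applied once in each argument. *)
Lemma reversible_integral u v :
  (forall x, 0 <= u x) -> measurable_fun setT u ->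
  (forall x, 0 <= v x) -> measurable_fun setT v ->
  \int[mu]_x (u x * \int[P x]_y v y) = \int[mu]_x (v x * \int[P x]_y u y).
Proof.
move=> u0 mu_ v0 mv; apply: rev_ind u0 mu_ => // A mA.
have i0 (B : set T) x : 0 <= (\1_B x : R)%:E by rewrite lee_fin.
have mi B : measurable B -> measurable_fun setT (fun x : T => (\1_B x : R)%:E).
  by move=> mB; exact/measurable_EFinP.
apply/esym; apply: (rev_ind (i0 A) (mi A mA) _ v0 mv) => B mB; rewrite /rev.
have E A' B' : measurable A' ->
    \int[mu]_x ((\1_B' x)%:E * \int[P x]_y (\1_A' y)%:E) =
    \int[mu]_(x in B') P x A'.
  move=> mA'; rewrite [RHS]integral_mkcond epatch_indic.
  by apply: eq_integral => x _ /=; rewrite integral_indic// setIT muleC.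
by rewrite !E//; exact: Prev.
Qed.

End reversible.

Lemma measurable_fun_div (R : realType) (d : measure_display)
    (T : measurableType d) (f V : T -> R) : measurable_fun setT f ->
  measurable_fun setT V -> (forall x, 0 < V x) ->
  measurable_fun setT (fun x => f x / V x).
Proof.
move=> mf mV V0; apply: measurable_funM => //.
rewrite (_ : (fun x => _) = (fun x => V x `^ (-1))); last first.
  by apply/funext => x; rewrite powR_inv1// ltW.
exact: measurableT_comp (measurable_powR _) mV.
Qed.

(** * Invariance and the weighted AM-GM inequality *)

Section lyapunov.
Context (R : realType) (d : measure_display) (T : measurableType d).
Variables (mu : probability T R) (P : R.-pker T ~> T).
Hypothesis Prev : kernel_reversible P mu.

(** Reversibility tested against the constant 1, which [P] preserves. *)
Lemma reversible_invariant_integral (v : T -> \bar R) :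
  (forall x, 0 <= v x)%E -> measurable_fun setT v ->
  (\int[mu]_x \int[P x]_y v y = \int[mu]_x v x)%E.
Proof.
move=> v0 mv.
transitivity (\int[mu]_x (cst 1 x * \int[P x]_y v y))%E.
  by apply: eq_integral => x _; rewrite mul1e.
rewrite (reversible_integral Prev); [|by []|exact: measurable_cst|by []|by []].
by apply: eq_integral => x _; rewrite integral_cst// mul1e prob_kernel mule1.
Qed.

(** The difference of the two sides is the square of |a| w - |b| v, divided by v w. *)
Lemma AMGM_weight (a b v w : R) : 0 < v -> 0 < w ->
  (`|a| * `|b|) * 2 <= a ^+ 2 / v * w + v * (b ^+ 2 / w).
Proof.
move=> v0 w0; rewrite -(real_normK (num_real a)) -(real_normK (num_real b)).
rewrite -subr_ge0 [leRHS](_ : _ = (`|a| * w - `|b| * v) ^+ 2 / (v * w)).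
  by rewrite mulr_ge0 ?sqr_ge0// invr_ge0 mulr_ge0 ?ltW.
by field; rewrite !gt_eqF.
Qed.

(** Integrate [AMGM_weight] with weights [V x] and [V y]. With u = g^2 / V the two terms on the
    right become <u, P V> and <V, P u>, which are equal by reversibility. *)
Lemma reversible_AMGM (g V : T -> R) : measurable_fun setT g ->
  measurable_fun setT V -> (forall x, 0 < V x) ->
  (\int[mu]_x (`|g x|%:E * \int[P x]_y `|g y|%:E) <=
   \int[mu]_x ((g x ^+ 2 / V x)%:E * \int[P x]_y (V y)%:E))%E.
Proof.
move=> mg mV V0.
pose u x := g x ^+ 2 / V x.
have u0 x : 0 <= u x by rewrite mulr_ge0 ?sqr_ge0// invr_ge0 ltW.
have mu_ : measurable_fun setT u.
  by apply: measurable_fun_div => //; exact: measurable_funX.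
have eu0 x : (0 <= (u x)%:E)%E by rewrite lee_fin.
have eV0 x : (0 <= (V x)%:E)%E by rewrite lee_fin ltW.
have eg0 x : (0 <= `|g x|%:E)%E by rewrite lee_fin.
have emu : measurable_fun setT (EFin \o u) by exact/measurable_EFinP.
have emV : measurable_fun setT (EFin \o V) by exact/measurable_EFinP.
have emg : measurable_fun setT (EFin \o (fun x => `|g x|)).
  by apply/measurable_EFinP; exact: measurableT_comp.
have mP v : (forall x, 0 <= v x)%E -> measurable_fun setT v ->
    measurable_fun setT (fun x => \int[P x]_y v y)%E.
  exact: measurable_kernel_integral.
rewrite -[leRHS]/(\int[mu]_x ((u x)%:E * \int[P x]_y (V y)%:E))%E.
rewrite -(@lee_pmul2r _ 2%:E)//.
rewrite -ge0_integralZr//; last 2 first.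
  by apply: emeasurable_funM => //; exact: mP.
  by move=> x _; apply: mule_ge0 => //; exact: integral_ge0.
rewrite [leRHS]muleC mule_natl mule2n.
rewrite [X in (_ <= _ + X)%E](reversible_integral Prev eu0 emu eV0 emV).
rewrite -ge0_integralD//; last 4 first.
  by move=> x _; apply: mule_ge0 => //; exact: integral_ge0.
  by apply: emeasurable_funM => //; exact: mP.
  by move=> x _; apply: mule_ge0 => //; exact: integral_ge0.
  by apply: emeasurable_funM => //; exact: mP.
apply: ge0_le_integral => //.
- by move=> x _; apply: mule_ge0 => //; apply: mule_ge0 => //; exact: integral_ge0.
- by apply: emeasurable_funM => //; apply: emeasurable_funM => //; exact: mP.
- by apply: emeasurable_funD; apply: emeasurable_funM => //; exact: mP.
move=> x _; rewrite -!ge0_integralZl_EFin//; last exact: ltW.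
have m1 : measurable_fun setT (fun y => `|g x|%:E * `|g y|%:E)%E.
  exact: measurable_funeM.
have m2 : measurable_fun setT (fun y => (u x)%:E * (V y)%:E)%E.
  exact: measurable_funeM.
have m3 : measurable_fun setT (fun y => (V x)%:E * (u y)%:E)%E.
  exact: measurable_funeM.
rewrite -ge0_integralZr//.
rewrite -ge0_integralD//; [|by move=> y _; apply: mule_ge0..].
apply: ge0_le_integral => //.
- exact: emeasurable_funM.
- exact: emeasurable_funD.
by move=> y _; rewrite -!EFinM -EFinD lee_fin; exact: AMGM_weight.
Qed.

End lyapunov.

(** * Consequences of the drift condition *)

Section drift.
Context (R : realType) (d : measure_display) (T : measurableType d).
Variables (mu : probability T R) (P : R.-pker T ~> T).
Hypothesis Prev : kernel_reversible P mu.
Variables (C : set T) (V psi : T -> R) (b : R).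
Hypothesis mC : measurable C.
Hypothesis mV : measurable_fun setT V.
Hypothesis V1 : forall x, 1 <= V x.
Hypothesis mpsi : measurable_fun setT psi.
Hypothesis psi0 : forall x, 0 <= psi x.
Hypothesis b0 : 0 <= b.
Hypothesis drift : forall x,
  (\int[P x]_y (V y)%:E <= (V x - psi x + b * \1_C x)%:E)%E.

Let V0 x : 0 < V x. Proof. exact: lt_le_trans ltr01 (V1 x). Qed.

(** After [reversible_AMGM], the drift condition multiplied by g^2 / V gives the inequality
    pointwise, with 1 / V <= 1 used in the [C] term. The form with sums avoids subtracting a cross
    term that could be infinite. *)
Lemma weighted_drift (g : T -> R) : measurable_fun setT g ->
  (\int[mu]_x (g x ^+ 2 * psi x / V x)%:E +
     \int[mu]_x (`|g x|%:E * \int[P x]_y `|g y|%:E) <=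
   \int[mu]_x (g x ^+ 2)%:E + b%:E * \int[mu]_x (g x ^+ 2 * \1_C x)%:E)%E.
Proof.
move=> mg.
have mg2 : measurable_fun setT (fun x => g x ^+ 2) by exact: measurable_funX.
have PV0 x : (0 <= \int[P x]_y (V y)%:E)%E.
  by apply: integral_ge0 => y _; rewrite lee_fin ltW.
have u0 x : 0 <= g x ^+ 2 / V x by rewrite mulr_ge0 ?sqr_ge0// invr_ge0 ltW.
have mPV : measurable_fun setT (fun x => \int[P x]_y (V y)%:E)%E.
  apply: measurable_kernel_integral; first by move=> x; rewrite lee_fin ltW.
  exact/measurable_EFinP.
apply: le_trans (leeD2l _ (reversible_AMGM Prev mg mV V0)) _.
have A0 x : (0 <= (g x ^+ 2 * psi x / V x)%:E)%E.
  by rewrite lee_fin mulrAC mulr_ge0.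
have mA : measurable_fun setT (fun x => (g x ^+ 2 * psi x / V x)%:E).
  by apply/measurable_EFinP; apply: measurable_fun_div => //; exact: measurable_funM.
have B0 x : (0 <= (g x ^+ 2 / V x)%:E * \int[P x]_y (V y)%:E)%E.
  by apply: mule_ge0; [rewrite lee_fin|exact: PV0].
have mB : measurable_fun setT
    (fun x => (g x ^+ 2 / V x)%:E * \int[P x]_y (V y)%:E)%E.
  apply: emeasurable_funM => //; apply/measurable_EFinP.
  exact: measurable_fun_div.
have D0 x : (0 <= (g x ^+ 2)%:E)%E by rewrite lee_fin sqr_ge0.
have mD : measurable_fun setT (fun x => (g x ^+ 2)%:E) by exact/measurable_EFinP.
have E0 x : (0 <= (g x ^+ 2 * \1_C x)%:E)%E.
  by rewrite lee_fin mulr_ge0 ?sqr_ge0.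
have mE : measurable_fun setT (fun x => (g x ^+ 2 * \1_C x)%:E).
  by apply/measurable_EFinP; exact: measurable_funM.
rewrite -ge0_integralZl_EFin// -!ge0_integralD//; last 2 first.
  by move=> x _; rewrite mule_ge0.
  exact: measurable_funeM.
apply: ge0_le_integral => //.
- by move=> x _; rewrite adde_ge0.
- exact: emeasurable_funD.
- by apply: emeasurable_funD => //; exact: measurable_funeM.
move=> x _.
apply: le_trans (leeD2l _ (lee_wpmul2l _ (drift x))) _; first by rewrite lee_fin.
rewrite -!EFinM -!EFinD lee_fin.
rewrite [leLHS](_ : _ = g x ^+ 2 + b * (g x ^+ 2 * \1_C x) / V x); last first.
  by field; rewrite gt_eqF.
rewrite lerD2l ler_piMr ?invf_le1//.
by rewrite mulr_ge0// mulr_ge0// sqr_ge0.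
Qed.

(** Integrating the drift condition would cancel [V] against P V by invariance, but [V] need not be
    integrable. The argument is run with [V] truncated at height n, and then n tends to infinity. *)
Lemma integral_drift : (\int[mu]_x (psi x)%:E <= b%:E * mu C)%E.
Proof.
have e0 (h : T -> R) : (forall x, 0 <= h x) -> forall x, (0 <= (h x)%:E)%E.
  by move=> h0 x; rewrite lee_fin.
pose W (n : nat) x := Order.min (V x) n%:R.
pose D (n : nat) := [set x | V x <= n%:R].
have mD n : measurable (D n).
  have := measurable_fun_le measurableT mV (measurable_cst (n%:R : R)).
  by rewrite setTI.
have W0 n x : 0 <= W n x by rewrite /W le_min ler0n ltW.
have mW n : measurable_fun setT (W n) by exact: measurable_minr.
have mpsiD n : measurable_fun setT (fun x => psi x * \1_(D n) x).
  exact: measurable_funM.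
have psiD0 n x : 0 <= psi x * \1_(D n) x by rewrite mulr_ge0.
have PW0 n x : (0 <= \int[P x]_y (W n y)%:E)%E.
  by apply: integral_ge0 => y _; exact: e0.
have mPW n : measurable_fun setT (fun x => \int[P x]_y (W n y)%:E)%E.
  by apply: measurable_kernel_integral => [x|]; [exact: e0|exact/measurable_EFinP].
have muC : mu C = (\int[mu]_x (\1_C x)%:E)%E by rewrite integral_indic// setIT.
have int_psiD n : (\int[mu]_x (psi x * \1_(D n) x)%:E <= b%:E * mu C)%E.
  (* Being bounded, [W n] has a finite integral, which can be added to both sides; on the left,
     invariance turns it into the integral of P (W n). *)
  have Wfin : (\int[mu]_x (W n x)%:E)%E \is a fin_num.
    apply: integrable_fin_num => //; apply: (le_integrable measurableT);
      last exact: (finite_measure_integrable_cst mu n%:R).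
      exact/measurable_EFinP.
    by move=> x _; rewrite /= lee_fin !ger0_norm// /W ge_min lexx orbT.
  rewrite -(@leeD2lE _ _ _ _ Wfin).
  rewrite -[X in (X + _ <= _)%E](reversible_invariant_integral Prev (e0 _ (W0 n)));
    last exact/measurable_EFinP.
  rewrite muC.
  have m1 : measurable_fun setT (fun x => (\1_C x : R)%:E).
    exact/measurable_EFinP.
  have m2 : measurable_fun setT (fun x => b%:E * (\1_C x : R)%:E)%E.
    exact: measurable_funeM.
  have m3 : measurable_fun setT (fun x => (psi x * \1_(D n) x)%:E).
    exact/measurable_EFinP.
  have m4 : measurable_fun setT (fun x => (W n x)%:E) by exact/measurable_EFinP.
  rewrite -ge0_integralZl_EFin// -ge0_integralD//; last first.
    by move=> x _; exact: (e0 _ (psiD0 n)).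
  rewrite -ge0_integralD//; [|by move=> x _; exact: e0|]; last first.
    by move=> x _; rewrite -EFinM lee_fin mulr_ge0.
  apply: ge0_le_integral => //.
  - by move=> x _; apply: adde_ge0 => //; exact: (e0 _ (psiD0 n)).
  - exact: emeasurable_funD.
  - exact: emeasurable_funD.
  move=> x _; rewrite -EFinM -EFinD.
  (* Where V <= n, P (W n) <= P V and the drift condition applies; elsewhere W n = n, which bounds P
     (W n) since [P] has mass one. *)
  have [xD|xD] := leP (V x) n%:R.
    have -> : \1_(D n) x = 1 :> R by rewrite indicE mem_set.
    rewrite mulr1 /W (min_idPl xD).
    rewrite [X in (_ <= X%:E)%E](_ : _ = V x - psi x + b * \1_C x + psi x);
      last by ring.
    rewrite EFinD leeD2r//; apply: (le_trans _ (drift x)).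
    apply: ge0_le_integral => //.
    - by move=> y _; exact: (e0 _ (W0 n)).
    - exact/measurable_EFinP.
    - by move=> y _; rewrite lee_fin ge_min lexx.
  have -> : \1_(D n) x = 0 :> R.
    by rewrite indicE memNset//= => /(lt_le_trans xD); rewrite ltxx.
  rewrite mulr0 adde0 /W [in leRHS](min_idPr (ltW xD)).
  apply: (@le_trans _ _ n%:R%:E); last by rewrite lee_fin lerDl mulr_ge0.
  have -> : (n%:R%:E = \int[P x]_y (cst n%:R%:E) y :> \bar R)%E.
    by rewrite integral_cst// prob_kernel mule1.
  apply: ge0_le_integral => //.
  - by move=> y _; exact: (e0 _ (W0 n)).
  - by move=> y _; rewrite lee_fin ge_min lexx orbT.
have ndD x m n : (m <= n)%N ->
    ((psi x * \1_(D m) x)%:E <= (psi x * \1_(D n) x)%:E)%E.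
  move=> mn; rewrite lee_fin ler_wpM2l// !indicE ler_nat.
  case: (boolP (x \in D m)) => //; rewrite inE => xm.
  by rewrite mem_set//=; apply: le_trans xm _; rewrite ler_nat.
(* The sets [D n] exhaust the space, so monotone convergence recovers the integral of [psi]. *)
have -> : (\int[mu]_x (psi x)%:E =
    limn (fun n => \int[mu]_x (psi x * \1_(D n) x)%:E))%E.
  rewrite -monotone_convergence//.
  - apply: eq_integral => x _; apply/esym/cvg_lim => //.
    apply: cvg_near_cst; near=> n; congr EFin.
    rewrite indicE mem_set ?mulr1//=.
    near: n; exact: nbhs_infty_ger.
  - by move=> n; exact/measurable_EFinP.
  - by move=> n x _; exact: (e0 _ (psiD0 n)).
  - by move=> x _ m n mn; exact: ndD.
apply: lime_le; last by apply: nearW => n; exact: int_psiD.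
apply: ereal_nondecreasing_is_cvgn => m n mn.
apply: ge0_le_integral => //.
- by move=> x _; exact: (e0 _ (psiD0 m)).
- exact/measurable_EFinP.
- exact/measurable_EFinP.
- by move=> x _; exact: ndD.
Unshelve. all: by end_near. Qed.

End drift.

(** * The kernel acting on integrable real functions *)

Section kernel_op.
Context (R : realType) (d : measure_display) (T : measurableType d).
Variables (mu : probability T R) (P : R.-pker T ~> T).
Hypothesis Prev : kernel_reversible P mu.
Implicit Types h : T -> R.

Lemma measurable_kernel_op h : measurable_fun setT h ->
  measurable_fun setT (kernel_op P h).
Proof.
move=> mh; have emh : measurable_fun setT (EFin \o h) by exact/measurable_EFinP.
apply: (measurableT_comp (fine_measurable measurableT)).
under eq_fun do rewrite integralE.
apply: emeasurable_funB; apply: measurable_kernel_integral => //.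
- exact: measurable_funepos.
- exact: measurable_funeneg.
Qed.

(** Where the integral of [h] is not a real number, [kernel_op] returns 0, so the bound holds at
    every point. *)
Lemma normr_kernel_op_le h x : measurable_fun setT h ->
  (`|kernel_op P h x|%:E <= \int[P x]_y `|h y|%:E)%E.
Proof.
move=> mh; have emh : measurable_fun setT (EFin \o h) by exact/measurable_EFinP.
have := le_abse_integral (P x) measurableT emh.
rewrite /kernel_op /Rintegral /=.
case: (\int[P x]_y (h y)%:E)%E => [r| |] //= _; rewrite normr0;
  by apply: integral_ge0 => y _; rewrite lee_fin.
Qed.

(** By invariance, P |h| has the same integral as |h|. *)
Lemma integrable_kernel_norm h : mu.-integrable setT (EFin \o h) ->
  mu.-integrable setT (fun x => \int[P x]_y `|h y|%:E)%E.
Proof.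
move=> /integrableP[mh hoo].
have h0 y : (0 <= `|h y|%:E)%E by rewrite lee_fin.
have mah : measurable_fun setT (fun y => `|h y|%:E).
  by apply/measurable_EFinP; apply: measurableT_comp => //; exact/measurable_EFinP.
apply/integrableP; split; first exact: measurable_kernel_integral.
under eq_integral do rewrite gee0_abs ?integral_ge0//.
by rewrite (reversible_invariant_integral Prev).
Qed.

(** The integrable function P |h| is finite almost everywhere. Hence the default value of
    [kernel_op] can occur only on a null set. *)
Lemma ae_integrable_kernel h : mu.-integrable setT (EFin \o h) ->
  {ae mu, forall x, (P x).-integrable setT (EFin \o h)}.
Proof.
move=> ih; have /integrableP[mh _] := ih.
have := integrable_ae measurableT (integrable_kernel_norm ih).
apply: filterS => x /(_ I) xfin; apply/integrableP; split => //.
by rewrite -ge0_fin_numE// integral_ge0.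
Qed.

Lemma integrable_kernel_op h : mu.-integrable setT (EFin \o h) ->
  mu.-integrable setT (EFin \o kernel_op P h).
Proof.
move=> ih; have /integrableP[/measurable_EFinP mh _] := ih.
apply: (le_integrable measurableT) (integrable_kernel_norm ih).
  by apply/measurable_EFinP; exact: measurable_kernel_op.
move=> x _; rewrite [leRHS]gee0_abs; first exact: normr_kernel_op_le.
by apply: integral_ge0 => y _; rewrite lee_fin.
Qed.

(** Invariance for nonnegative functions is applied to the positive and negative parts of [h]; the
    difference agrees with [kernel_op] almost everywhere, which suffices. *)
Lemma Rintegral_kernel_op h : mu.-integrable setT (EFin \o h) ->
  \int[mu]_x kernel_op P h x = \int[mu]_x h x.
Proof.
move=> ih; have /integrableP[mh _] := ih.
pose Pp x := (\int[P x]_y (EFin \o h)^\+ y)%E.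
pose Pn x := (\int[P x]_y (EFin \o h)^\- y)%E.
have mPp : measurable_fun setT Pp.
  by apply: measurable_kernel_integral => //; exact: measurable_funepos.
have mPn : measurable_fun setT Pn.
  by apply: measurable_kernel_integral => //; exact: measurable_funeneg.
have Pp0 x : (0 <= Pp x)%E by exact: integral_ge0.
have Pn0 x : (0 <= Pn x)%E by exact: integral_ge0.
have intPp : (\int[mu]_x Pp x = \int[mu]_x (EFin \o h)^\+ x)%E.
  by rewrite (reversible_invariant_integral Prev)//; exact: measurable_funepos.
have intPn : (\int[mu]_x Pn x = \int[mu]_x (EFin \o h)^\- x)%E.
  by rewrite (reversible_invariant_integral Prev)//; exact: measurable_funeneg.
have iPp : mu.-integrable setT Pp.
  apply/integrableP; split => //.
  under eq_integral do rewrite gee0_abs//.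
  by rewrite intPp; exact: integral_funepos_lt_pinfty.
have iPn : mu.-integrable setT Pn.
  apply/integrableP; split => //.
  under eq_integral do rewrite gee0_abs//.
  by rewrite intPn; exact: integral_funeneg_lt_pinfty.
congr fine; rewrite [RHS]integralE -intPp -intPn -integralB//.
apply: ae_eq_integral => //.
- by apply/measurable_EFinP; apply: measurable_kernel_op; exact/measurable_EFinP.
- exact: emeasurable_funB.
apply: filterS (ae_integrable_kernel ih) => x ihx _ /=.
rewrite /Pp /Pn -integralE /kernel_op /Rintegral fineK//.
exact: integrable_fin_num.
Qed.

End kernel_op.

(** * The Dirichlet form on square integrable functions *)

Section dirichlet.
Context (R : realType) (d : measure_display) (T : measurableType d).
Variables (mu : probability T R) (P : R.-pker T ~> T).
Hypothesis Prev : kernel_reversible P mu.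
Implicit Types f g : T -> R.

Lemma Lfun2_measurable g : g \in Lfun mu 2%:E -> measurable_fun setT g.
Proof. by rewrite inE => /andP[+ _]; rewrite inE. Qed.

Lemma Lfun2_integrable g : g \in Lfun mu 2%:E -> mu.-integrable setT (EFin \o g).
Proof.
by move/(Lfun_subset12 (fin_num_measure mu _ measurableT))/Lfun1_integrable.
Qed.

Lemma norm2_expe2 g : (norm2 mu g ^+ 2 = \int[mu]_x (g x ^+ 2)%:E)%E.
Proof.
transitivity (norm2 mu g `^ 2)%E.
  have := Lnorm_ge0 mu 2%:E (EFin \o g); rewrite -/(norm2 mu g).
  case: (norm2 mu g) => [r| |]//; last by rewrite poweRyr.
  by rewrite lee_fin => r0; rewrite poweR_EFin powR_mulrn.
rewrite /norm2 poweR_Lnorm//; apply: eq_integral => x _ /=.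
by rewrite powR_mulrn// real_normK// num_real.
Qed.

(** [reversible_AMGM] with [V] equal to 1 bounds this integral by that of g^2. *)
Lemma integral_mul_kernel_lty g : g \in Lfun mu 2%:E ->
  (\int[mu]_x (`|g x|%:E * \int[P x]_y `|g y|%:E) < +oo)%E.
Proof.
move=> g2; have mg := Lfun2_measurable g2.
apply: le_lt_trans (@reversible_AMGM _ _ _ _ _ Prev g (cst 1) mg _ _) _ => //.
have /integrableP[_] := Lfun2_integrable_sqr g2.
apply: le_lt_trans; rewrite le_eqVlt; apply/orP; left; apply/eqP.
apply: eq_integral => x _ /=.
by rewrite divr1 integral_cst// prob_kernel !mule1 ger0_norm// sqr_ge0.
Qed.

Lemma integrable_kernel_op_mul g : g \in Lfun mu 2%:E ->
  mu.-integrable setT (EFin \o (fun x => kernel_op P g x * g x)).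
Proof.
move=> g2; have mg := Lfun2_measurable g2; have ig := Lfun2_integrable g2.
have /integrableP[mPg _] := integrable_kernel_norm Prev ig.
apply/integrableP; split.
  apply/measurable_EFinP; apply: measurable_funM => //.
  exact: measurable_kernel_op.
apply: le_lt_trans (integral_mul_kernel_lty g2).
apply: ge0_le_integral => //.
- apply: measurableT_comp => //; apply/measurable_EFinP.
  by apply: measurable_funM => //; exact: measurable_kernel_op.
- apply: emeasurable_funM => //.
  by apply/measurable_EFinP; exact: measurableT_comp.
- move=> x _; rewrite /= normrM EFinM muleC lee_wpmul2l ?lee_fin//.
  exact: normr_kernel_op_le.
Qed.

(** The squared norm is E(g) + <P g, g>, and <P g, g> <= <|g|, P |g|>. The last term also stands on
    the left of [weighted_drift], where it will cancel. *)
Lemma dirichlet_ge g : g \in Lfun mu 2%:E ->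
  (\int[mu]_x (g x ^+ 2)%:E <= (dirichlet mu P g)%:E +
    \int[mu]_x (`|g x|%:E * \int[P x]_y `|g y|%:E))%E.
Proof.
move=> g2; have mg := Lfun2_measurable g2.
have igg := Lfun2_integrable_sqr g2; have iPgg := integrable_kernel_op_mul g2.
have /integrableP[mPg _] := integrable_kernel_norm Prev (Lfun2_integrable g2).
have -> : dirichlet mu P g =
    \int[mu]_x (g x ^+ 2) - \int[mu]_x (kernel_op P g x * g x).
  rewrite -RintegralB//; apply: eq_Rintegral => x _ /=.
  by rewrite mulrBl expr2.
rewrite EFinB fineK; last exact: integrable_fin_num.
rewrite fineK; last exact: integrable_fin_num.
rewrite -addeA leeDl// addeC sube_ge0; last first.
  by rewrite integrable_fin_num ?orbT.
apply: le_trans (lee_abs _) _.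
apply: le_trans (le_abse_integral _ _ _) _ => //; first by case/integrableP: iPgg.
apply: ge0_le_integral => //.
- by apply: measurableT_comp => //; case/integrableP: iPgg.
- apply: emeasurable_funM => //.
  by apply/measurable_EFinP; exact: measurableT_comp.
- move=> x _; rewrite /= normrM EFinM muleC lee_wpmul2l ?lee_fin//.
  exact: normr_kernel_op_le.
Qed.

(** Since [P] fixes constants, the shift leaves (Id - P) f unchanged; the extra term, m times the
    integral of f - P f, is zero by invariance. *)
Lemma dirichlet_shift f m : f \in Lfun mu 2%:E ->
  dirichlet mu P (fun x => f x - m) = dirichlet mu P f.
Proof.
move=> f2; have mf := Lfun2_measurable f2; have jf := Lfun2_integrable f2.
have iPf := integrable_kernel_op Prev jf.
have mPf := measurable_kernel_op P mf.
have iff := Lfun2_integrable_sqr f2; have iPff := integrable_kernel_op_mul f2.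
have icst : mu.-integrable setT (EFin \o cst m).
  exact: finite_measure_integrable_cst.
have iD : mu.-integrable setT (EFin \o (f \- kernel_op P f)).
  exact: (integrableB measurableT jf iPf).
have iDf : mu.-integrable setT (EFin \o ((f \- kernel_op P f) \* f)).
  apply: eq_integrable (integrableB measurableT iff iPff) => // x _ /=.
  by rewrite -EFinB mulrBl expr2.
have -> : dirichlet mu P (fun x => f x - m) =
    \int[mu]_x ((f x - kernel_op P f x) * f x - (f x - kernel_op P f x) * m).
  (* P (f - m) = P f - m uses linearity of the integral, available where [f] is integrable for
     [P x], hence almost everywhere. *)
  congr fine; apply: ae_eq_integral => //.
  - apply/measurable_EFinP; apply: measurable_funM; last exact: measurable_funB.
    apply: measurable_funB; first exact: measurable_funB.
    by apply: measurable_kernel_op; exact: measurable_funB.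
  - apply/measurable_EFinP; apply: measurable_funB; apply: measurable_funM => //;
    exact: measurable_funB.
  - apply: filterS (ae_integrable_kernel Prev jf) => x jfx _ /=; congr EFin.
    have -> : kernel_op P (fun y => f y - m) x = kernel_op P f x - m.
      rewrite /kernel_op RintegralB//.
        by rewrite Rintegral_cst// prob_kernel mulr1.
      apply/integrableP; split; first exact/measurable_EFinP.
      by rewrite /= integral_cst// prob_kernel mule1 ltry.
    ring.
rewrite RintegralB//; last first.
  apply: eq_integrable (integrableZr measurableT m iD) => //.
rewrite RintegralZr// RintegralB// (Rintegral_kernel_op Prev)//.
by rewrite subrr mul0r subr0.
Qed.

End dirichlet.

(** * Oscillation and essential bounds *)

Section oscillation.
Context (R : realType) (d : measure_display) (T : measurableType d).
Variable mu : probability T R.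
Implicit Types f h : T -> R.

(** As [mu] has mass one, an almost sure property holds at some point. So the essential supremum is
    not [-oo] and the essential infimum is not [+oo]. *)
Lemma osc_real_or_pinfty f : osc mu f = +oo%E \/
  exists a b, [/\ osc mu f = (b - a)%:E,
    {ae mu, forall x, a <= f x} & {ae mu, forall x, f x <= b}].
Proof.
have muT : (0 < mu setT)%E by rewrite probability_setT lte01.
have mu_proper := ae_properfilter_algebraOfSetsType muT.
have fs := ess_sup_ge mu (EFin \o f); have fi := ess_inf_le mu (EFin \o f).
rewrite /osc; move: fs fi.
case: (ess_sup mu _) => [b| |]; case: (ess_inf mu _) => [a| |] fs fi;
  try by [left | have [x] := filter_ex fs | have [x] := filter_ex fi].
by right; exists a, b; split.
Qed.

Lemma ae_Rintegral_ge0 h : measurable_fun setT h ->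
  {ae mu, forall x, 0 <= h x} -> 0 <= \int[mu]_x h x.
Proof.
move=> mh h0; rewrite /Rintegral.
rewrite (@ae_eq_integral _ _ _ mu _ (fun x => `|h x|%:E))//.
- by rewrite fine_ge0//; apply: integral_ge0 => x _; rewrite lee_fin.
- exact/measurable_EFinP.
- by apply/measurable_EFinP; exact: measurableT_comp.
- by apply: filterS h0 => x h0 _; rewrite ger0_norm.
Qed.

(** Averaging over [C] preserves the bounds, so the mean lies in [a, b], as does almost every f
    x. *)
Lemma ae_dist_mean_le (C : set T) f (a b : R) : measurable C -> mu C != 0%E ->
  mu.-integrable setT (EFin \o f) ->
  {ae mu, forall x, a <= f x} -> {ae mu, forall x, f x <= b} ->
  {ae mu, forall x,
    `|f x - (\int[mu]_y (f y * \1_C y)) / fine (mu C)| <= b - a}.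
Proof.
move=> mC C0 jf af fb; set m := _ / _.
have /integrableP[/measurable_EFinP mf _] := jf.
have c0 : 0 < fine (mu C).
  by rewrite fine_gt0// lt0e C0 measure_ge0 -ge0_fin_numE// fin_num_measure.
have mfC : measurable_fun setT (fun x => f x * \1_C x) by exact: measurable_funM.
have jfC : mu.-integrable setT (EFin \o (fun x => f x * \1_C x)).
  apply: (le_integrable measurableT) jf; first exact/measurable_EFinP.
  move=> x _ /=; rewrite lee_fin normrM ler_piMr// indicE.
  by case: (_ \in _); rewrite /= ?normr1 ?normr0.
have jC c : mu.-integrable setT (EFin \o (fun x => c * \1_C x)).
  exact: (integrableZl measurableT c (integrable_indic mu mC)).
have intC c : \int[mu]_x (c * \1_C x) = c * fine (mu C).
  rewrite RintegralZl//; last exact: integrable_indic.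
  by rewrite /Rintegral integral_indic// setIT.
have mb : m <= b.
  rewrite ler_pdivrMr// -subr_ge0 -intC -RintegralB//.
  apply: ae_Rintegral_ge0; first by apply: measurable_funB => //; exact: measurable_funM.
  by apply: filterS fb => x fxb; rewrite -mulrBl mulr_ge0// subr_ge0.
have am : a <= m.
  rewrite ler_pdivlMr// -subr_ge0 -intC -RintegralB//.
  apply: ae_Rintegral_ge0; first by apply: measurable_funB => //; exact: measurable_funM.
  by apply: filterS af => x axf; rewrite -mulrBl mulr_ge0// subr_ge0.
apply: filterS2 af fb => x afx fxb; rewrite ler_norml; apply/andP; split; lra.
Qed.

End oscillation.

(** * Centering in mean square *)

Section centering.
Context (R : realType) (d : measure_display) (T : measurableType d).
Variable mu : probability T R.
Implicit Types f : T -> R.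

Lemma Lfun2_shift f m : f \in Lfun mu 2%:E -> (fun x => f x - m) \in Lfun mu 2%:E.
Proof.
move=> f2; have p1 : (1 <= 2%:E :> \bar R)%E by rewrite lee_fin ler1n.
have [_ addc] := Lfun_addr_closed mu p1.
exact: (addc f (cst (- m)) f2 (Lfun_cst mu (- m) 2)).
Qed.

(** (f - m)^2 - f^2 = m^2 - 2 m f, which integrates to m^2 because [f] is centred. *)
Lemma integral_sqr_le_shift f m : f \in Lfun mu 2%:E -> \int[mu]_x f x = 0 ->
  (\int[mu]_x (f x ^+ 2)%:E <= \int[mu]_x ((f x - m) ^+ 2)%:E)%E.
Proof.
move=> f2 f0; have jf := Lfun2_integrable f2.
have jff := Lfun2_integrable_sqr f2.
have jgg := Lfun2_integrable_sqr (Lfun2_shift m f2).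
rewrite -[leLHS]fineK ?integrable_fin_num// -[leRHS]fineK ?integrable_fin_num//.
rewrite lee_fin -subr_ge0.
rewrite -/(Rintegral mu setT (fun x => (f x - m) ^+ 2)).
rewrite -/(Rintegral mu setT (fun x => f x ^+ 2)) -RintegralB//.
have -> : \int[mu]_x ((f x - m) ^+ 2 - f x ^+ 2) =
    \int[mu]_x (m ^+ 2 - (2 * m) * f x).
  by apply: eq_Rintegral => x _; ring.
rewrite RintegralB//; last 2 first.
  exact: finite_measure_integrable_cst.
  exact: (integrableZl measurableT _ jf).
rewrite [X in _ - X]RintegralZl// f0 mulr0 subr0 Rintegral_cst//.
by rewrite mulr_ge0 ?sqr_ge0// fine_ge0.
Qed.

End centering.

(** * The weighted Poincaré inequality and the final estimate *)

(** Write J for <|g|, P |g|> with g = f - m. Inserting [dirichlet_ge] into [weighted_drift] puts J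
    on both sides; J is finite and cancels. The local Poincaré inequality then bounds the [C] term
    by b K E(f). *)
Lemma weighted_poincare (R : realType) (d : measure_display)
    (T : measurableType d) (mu : probability T R) (P : R.-pker T ~> T)
    (C : set T) (V psi : T -> R) (b K m : R) (f : T -> R) :
  kernel_reversible P mu -> measurable C ->
  measurable_fun setT V -> (forall x, 1 <= V x) ->
  measurable_fun setT psi -> (forall x, 0 <= psi x) -> 0 <= b ->
  (forall x, (\int[P x]_y (V y)%:E <= (V x - psi x + b * \1_C x)%:E)%E) ->
  f \in Lfun mu 2%:E ->
  (norm2 mu (fun x => (f x - m) * \1_C x)%R ^+ 2 <= (K * dirichlet mu P f)%:E)%E ->
  (\int[mu]_x ((f x - m) ^+ 2 * psi x / V x)%:E <=
   ((1 + K * b) * dirichlet mu P f)%:E)%E.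
Proof.
move=> Prev mC mV V1 mpsi psi0 b0 drift f2 poincare.
have g2 := Lfun2_shift m f2.
have Jfin : (\int[mu]_x (`|f x - m|%:E * \int[P x]_y `|f y - m|%:E))%E \is a fin_num.
  rewrite ge0_fin_numE ?(integral_mul_kernel_lty Prev g2)//.
  apply: integral_ge0 => x _; apply: mule_ge0; first by rewrite lee_fin.
  by apply: integral_ge0 => y _; rewrite lee_fin.
rewrite -(leeD2rE _ _ Jfin).
have := weighted_drift Prev mC mV V1 mpsi psi0 b0 drift (Lfun2_measurable g2).
move=> /le_trans; apply.
apply: le_trans (leeD2r _ (dirichlet_ge Prev g2)) _.
rewrite (dirichlet_shift Prev _ f2) addeAC leeD2rE//.
rewrite mulrDl mul1r EFinD leeD2l// [K * b]mulrC -mulrA EFinM.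
apply: lee_wpmul2l; first by rewrite lee_fin.
apply: le_trans poincare; rewrite norm2_expe2 le_eqVlt; apply/orP; left; apply/eqP.
apply: eq_integral => x _; congr EFin; rewrite exprMn indicE.
by case: (_ \in _); rewrite /= ?expr1n ?expr0n.
Qed.

Lemma geninv_ge1 (R : realType) (g : R -> R) (r : R) : (1 <= geninv g r)%E.
Proof. by apply: le_ereal_inf_tmp => _ [y [y1 _] <-]; rewrite lee_fin. Qed.

Lemma geninv_le (R : realType) (g : R -> R) (r x : R) :
  1 <= x -> r <= g x -> (geninv g r <= x%:E)%E.
Proof. by move=> x1 rx; apply: ereal_inf_lbound; exists x. Qed.

Unset Implicit Arguments.
Theorem theorem73 (R : realType) (d : measure_display) (T : measurableType d)
  (mu : probability T R) (P : R.-pker T ~> T)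
  (Prev : kernel_reversible P mu)
  (Puniq : unique_invariant P mu)
  (C : set T) (mC : measurable C)
  (V : T -> R) (mV : measurable_fun [set: T] V) (V1 : forall x, 1 <= V x)
  (b : R) (b0 : 0 < b)
  (phi : R -> R)
  (phi_pos : forall x, 1 <= x -> 0 < phi x)
  (phi_concave : convex_function (E := R^o) `[1, +oo[ (fun x => - phi x))
  (phi_cont : {within `[1, +oo[, continuous phi})
  (phi_incr : {in `[1, +oo[ &, {homo phi : x y / x <= y}})
  (drift : forall x,
    (\int[P x]_y (V y)%:E <= (V x - phi (V x) + b * \1_C x)%:E)%E)
  (K : R) (K0 : 0 < K)
  (poincare : forall f : T -> R, f \in Lfun mu 2%:E ->
    let m := (\int[mu]_x (f x * \1_C x)) / fine (mu C) in
    (norm2 mu (fun x => (f x - m) * \1_C x)%R ^+ 2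
       <= (K * dirichlet mu P f)%:E)%E)
  (f : T -> R) (fL2 : f \in Lfun mu 2%:E) (f0 : \int[mu]_x f x = 0)
  (s : R) (s0 : 0 < s) :
  (norm2 mu f ^+ 2
     <= (s * dirichlet mu P f)%:E + wpi_beta mu C phi b K s * osc mu f ^+ 2)%E.
Proof.
pose psi x := phi (V x).
have psi0 x : 0 < psi x by exact: phi_pos.
have psi0' x : 0 <= psi x by exact: ltW.
have VE x : V x \in `[1, +oo[ by rewrite in_itv /= V1.
(* Continuity of [phi] is given on [1, +oo[ only, so its measurability is used there, where [V]
   takes its values. *)
have mpsi : measurable_fun setT psi.
  have mphi : measurable_fun (`[1, +oo[%classic : set R) phi.
    exact: subspace_continuous_measurable_fun.
  have VS : V @` setT `<=` `[1, +oo[ by move=> _ [x _ <-] /=; exact: VE.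
  exact: (measurable_comp (measurable_itv _) VS mphi mV).
set m := (\int[mu]_x (f x * \1_C x)) / fine (mu C).
set D := dirichlet mu P f.
pose g x := f x - m.
have mg : measurable_fun setT g := Lfun2_measurable (Lfun2_shift m fL2).
have c0 : 0 < 1 + K * b by rewrite addr_gt0// mulr_gt0.
(* Chosen so that multiplication by [r] turns the constant 1 + K b of the weighted inequality into
   [s]. *)
set r := s / (1 + K * b).
have r0 : 0 < r by rewrite divr_gt0.
have wA : (\int[mu]_x (g x ^+ 2 * psi x / V x)%:E <= ((1 + K * b) * D)%:E)%E.
  exact: (weighted_poincare Prev mC mV V1 mpsi psi0' (ltW b0) drift fL2
    (poincare f fL2)).
have rA : (r%:E * \int[mu]_x (g x ^+ 2 * psi x / V x)%:E <= (s * D)%:E)%E.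
  have -> : s * D = r * ((1 + K * b) * D) by rewrite /r; field; rewrite gt_eqF.
  by rewrite [leRHS]EFinM; apply: lee_wpmul2l => //; rewrite lee_fin ltW.
have ipsi := integral_drift Prev mC mV V1 mpsi psi0' (ltW b0) drift.
(* If mu(C) were 0, [ipsi] would make the integral of [psi] nonpositive, whereas psi >= phi 1 >
   0. *)
have muC0 : mu C != 0%E.
  apply/eqP => muC0; move: ipsi; rewrite muC0 mule0 leNgt => /negP; apply.
  apply: (@lt_le_trans _ _ (phi 1)%:E); first by rewrite lte_fin phi_pos.
  have -> : ((phi 1)%:E = \int[mu]_x cst (phi 1)%:E x :> \bar R)%E.
    by rewrite integral_cst// [X in (_ * X)%E]probability_setT mule1.
  apply: ge0_le_integral => //.
  - by move=> x _; rewrite lee_fin ltW// phi_pos.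
  - exact/measurable_EFinP.
  - by move=> x _; rewrite lee_fin; apply: phi_incr => //; rewrite in_itv /= lexx.
have V0 x : 0 < V x by exact: lt_le_trans (V1 x).
have h0 x : 0 <= g x ^+ 2 * psi x / V x.
  by apply: divr_ge0; [apply: mulr_ge0; [exact: sqr_ge0|]|exact: ltW].
have mh : measurable_fun setT (fun x => (g x ^+ 2 * psi x / V x)%:E).
  apply/measurable_EFinP; apply: measurable_fun_div => //.
  by apply: measurable_funM => //; exact: measurable_funX.
have mg2 : measurable_fun setT (fun x => (g x ^+ 2)%:E).
  by apply/measurable_EFinP; exact: measurable_funX.
have small x : V x / psi x <= r -> g x ^+ 2 <= r * (g x ^+ 2 * psi x / V x).
  rewrite ler_pdivrMr// => Vr.
  have -> : r * (g x ^+ 2 * psi x / V x) = g x ^+ 2 * (r * psi x / V x) by ring.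
  by rewrite ler_peMr ?sqr_ge0// ler_pdivlMr// mul1r.
rewrite norm2_expe2; apply: le_trans (integral_sqr_le_shift m fL2 f0) _.
rewrite -[leLHS]/(\int[mu]_x (g x ^+ 2)%:E)%E.
rewrite /wpi_beta -/r.
have := geninv_ge1 (fun x => x / phi x) r.
have := @geninv_le R (fun x => x / phi x) r.
(* Being at least 1, [geninv] is either a real [x0] or [+oo]. *)
case: (geninv _ _) => [x0| |] //= inv_le.
- rewrite lee_fin => x01.
  have p0 : 0 < phi x0 by exact: phi_pos.
  have -> : (b%:E * mu C / (phi x0)%:E = (b * fine (mu C) / phi x0)%:E)%E.
    by rewrite inver gt_eqF// -[mu C in LHS]fineK ?fin_num_measure// -!EFinM.
  have beta0 : 0 < b * fine (mu C) / phi x0.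
    rewrite divr_gt0// mulr_gt0// fine_gt0// lt0e muC0 measure_ge0.
    by rewrite -ge0_fin_numE// fin_num_measure.
  (* If the oscillation is infinite, positivity of beta makes the right-hand side [+oo]. *)
  have [->|[a [c [-> af fc]]]] := osc_real_or_pinfty mu f.
    by rewrite mulyy gt0_muley ?lte_fin// addey// leey.
  have gac := ae_dist_mean_le mC muC0 (Lfun2_integrable fL2) af fc.
  have k0 : 0 <= (c - a) ^+ 2 / phi x0 by rewrite divr_ge0 ?sqr_ge0// ltW.
  (* The sum majorizes g^2 almost everywhere: the first term suffices where V / psi <= r; elsewhere
     V >= x0, so psi / phi x0 >= 1, while |g| <= c - a. This is Markov's inequality for [psi] at the
     level of integrands. *)
  apply: (@le_trans _ _ (\int[mu]_x (r%:E * (g x ^+ 2 * psi x / V x)%:E +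
      ((c - a) ^+ 2 / phi x0)%:E * (psi x)%:E))%E).
    apply: ae_ge0_le_integral => //.
    - by move=> x _; rewrite lee_fin sqr_ge0.
    - by move=> x _; rewrite -!EFinM -EFinD lee_fin addr_ge0// mulr_ge0// ltW.
    - apply: emeasurable_funD; apply: measurable_funeM => //.
      exact/measurable_EFinP.
    - apply: filterS gac => x gx _; rewrite -!EFinM -EFinD lee_fin.
      have [/small Vr|/ltW rV] := leP (V x / psi x) r.
        by apply: le_trans Vr _; rewrite lerDl mulr_ge0.
      have := inv_le (V x) (V1 x) rV; rewrite lee_fin => x0V.
      have pp : phi x0 <= psi x by apply: phi_incr => //; rewrite in_itv /= x01.
      apply: (@le_trans _ _ ((c - a) ^+ 2 / phi x0 * psi x)); last first.
        by rewrite lerDr mulr_ge0// ltW.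
      apply: (@le_trans _ _ ((c - a) ^+ 2)).
        by rewrite -(real_normK (num_real (g x))) lerXn2r ?nnegrE ?(le_trans _ gx).
      by rewrite -mulrA ler_peMr ?sqr_ge0// mulrC ler_pdivlMr// mul1r.
  rewrite ge0_integralD//; last 4 first.
    by move=> x _; rewrite -EFinM lee_fin mulr_ge0// ltW.
    exact: measurable_funeM.
    by move=> x _; rewrite -EFinM lee_fin mulr_ge0.
    by apply: measurable_funeM; exact/measurable_EFinP.
  rewrite ge0_integralZl_EFin//; last exact: ltW.
    2: by move=> x _; rewrite lee_fin.
  rewrite ge0_integralZl_EFin//; last exact/measurable_EFinP.
    2: by move=> x _; rewrite lee_fin.
  apply: leeD => //.
  have -> : ((b * fine (mu C) / phi x0)%:E * ((c - a)%:E * (c - a)%:E) =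
      ((c - a) ^+ 2 / phi x0)%:E * (b%:E * mu C))%E.
    rewrite -[mu C in RHS]fineK ?fin_num_measure// -!EFinM; congr EFin.
    by rewrite expr2; ring.
  by apply: lee_wpmul2l => //; rewrite lee_fin.
(* Here [phi] is extended by [+oo], so beta is 0 and so is its product with the squared oscillation,
   even an infinite one. No point has V / psi > r, since [inv_le] would put [V] above [+oo]. *)
- move=> _; rewrite invey mule0 mul0e adde0; apply: le_trans rA.
  rewrite -ge0_integralZl_EFin//; last exact: ltW.
    2: by move=> x _; rewrite lee_fin.
  apply: ge0_le_integral => //.
  - by move=> x _; rewrite lee_fin sqr_ge0.
  - exact: measurable_funeM.
  move=> x _; rewrite -EFinM lee_fin small// leNgt; apply/negP => /ltW rV.
  by have := inv_le (V x) (V1 x) rV.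
Qed.
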